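(* Let $R$ be a semiring possessing a projective minimal left (or right) ideal. Then $R$ is ideal-simple if and only if $R$ is either isomorphic to a matrix semiring $M_n(F)$, $n\ge 1$, over a division ring $F$, or strongly semiisomorphic to the endomorphism semiring $\mathbf{E}_M$ of a nonzero finite distributive lattice $M$.
   Context: A semiring $(R,+,\cdot,0,1)$ consists of a commutative monoid $(R,+,0)$ and a monoid $(R,\cdot,1)$ such that multiplication distributes over addition on both sides and $0r=0=r0$ for all $r\in R$. An ideal (left, right ideal) is an additive submonoid closed under two-sided (left, right) multiplication by elements of $R$. $R$ is ideal-simple if $0$ and $R$ are its only ideals. A left $R$-semimodule is a commutative monoid $M$ with a unital, associative scalar multiplication $R\times M\to M$ that is additive in each variable and satisfies $r0_M=0_M=0m$ (right semimodules dually). A semimodule is projective if it is a retract of a free semimodule (a direct sum of copies of the regular semimodule). A minimal left (right) ideal is a nonzero left (right) ideal containing no nonzero left (right) ideal properly; it is projective if it is projective as a left (right) $R$-semimodule. A surjective semiring homomorphism $f:R\to S$ is a semiisomorphism if $\mathrm{Ker}(f)=\{x: f(x)=0\}=\{0\}$, and a strong semiisomorphism if moreover for every proper ideal $I$ of $R$ the ideal $f(I)$ of $S$ is proper; $R$ is strongly semiisomorphic to $S$ if there is a strong semiisomorphism $R\to S$. For a lattice $M$ with least element $0$, $\mathbf{E}_M$ is the semiring of all endomorphisms of the monoid $(M,\vee,0)$ with pointwise addition (join) and composition. *)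

(* Defs.v *)
From HB Require Import structures.
From mathcomp Require Import all_boot all_order all_algebra finmap.
From mathcomp Require Import boolp classical_sets.

Set Implicit Arguments.
Unset Strict Implicit.
Unset Printing Implicit Defensive.

Import Order.TTheory GRing.Theory.

Local Open Scope classical_set_scope.
Local Open Scope ring_scope.

Section Ideals.
Variable R : pzSemiRingType.
Implicit Type I : set R.

Definition left_ideal I :=
  [/\ I 0,
      forall x y, I x -> I y -> I (x + y) &
      forall r x, I x -> I (r * x)].

Definition ideal I :=
  left_ideal I /\ forall r x, I x -> I (x * r).

Definition ideal_simple :=
  forall I, ideal I -> I = [set 0] \/ I = setT.

Definition minimal_left_ideal I :=
  [/\ left_ideal I, I <> [set 0] &
      forall J, left_ideal J -> J <> [set 0] -> J `<=` I -> J = I].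

End Ideals.

(* The left semimodule carried by a left ideal. The (unused) proof argument
   makes the algebraic structure inferable from the type. *)
Section LeftIdealSemimodule.
Variables (R : pzSemiRingType) (I : set R) (hI : left_ideal I).

Definition left_ideal_elt of left_ideal I : Type := {x : R^o | x \in I}.

HB.instance Definition _ := SubChoice.on (left_ideal_elt hI).

Fact left_ideal_closed :
  GRing.subsemimod_closed ((fun x : R^o => x \in I) : {pred R^o}).
Proof.
case: (hI) => I0 ID IM; split; first split.
- exact/mem_set.
- by move=> x y /set_mem Ix /set_mem Iy; apply/mem_set/ID.
- by move=> r x /set_mem Ix; apply/mem_set/IM.
Qed.

HB.instance Definition _ :=
  GRing.SubChoice_isSubLSemiModule.Build R R^o (fun x : R^o => x \in I)
    (left_ideal_elt hI) left_ideal_closed.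

End LeftIdealSemimodule.

(* The free left semimodule R^(X): finitely supported functions X -> R with the
   pointwise operations. *)
Section FreeSemimodule.
Variables (R : pzSemiRingType) (X : choiceType).

Definition free_semimod : Type := {fsfun X -> R with 0}.

HB.instance Definition _ := Choice.on free_semimod.

Implicit Types f g h : free_semimod.

Definition free_zero : free_semimod := [fsfun].

Definition free_add f g : free_semimod :=
  [fsfun x in (finsupp f `|` finsupp g)%fset => f x + g x].

Definition free_scale (r : R) f : free_semimod :=
  [fsfun x in finsupp f => r * f x].

Fact free_zeroE x : free_zero x = 0.
Proof. by rewrite fsfun_dflt // finsupp0. Qed.

Fact free_addE f g x : free_add f g x = f x + g x.
Proof.
rewrite fsfun_fun in_fsetU; case: ifPn => // /norP[fx gx].
by rewrite !fsfun_dflt ?addr0.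
Qed.

Fact free_scaleE r f x : free_scale r f x = r * f x.
Proof.
by rewrite fsfun_fun; case: ifPn => // fx; rewrite fsfun_dflt ?mulr0.
Qed.

Fact free_addA : associative free_add.
Proof. by move=> f g h; apply/fsfunP => x; rewrite !free_addE addrA. Qed.

Fact free_addC : commutative free_add.
Proof. by move=> f g; apply/fsfunP => x; rewrite !free_addE addrC. Qed.

Fact free_add0 : left_id free_zero free_add.
Proof. by move=> f; apply/fsfunP => x; rewrite free_addE free_zeroE add0r. Qed.

HB.instance Definition _ :=
  GRing.isNmodule.Build free_semimod free_addA free_addC free_add0.

Fact free_scaleA a b f : free_scale a (free_scale b f) = free_scale (a * b) f.
Proof. by apply/fsfunP => x; rewrite !free_scaleE mulrA. Qed.

Fact free_scale0 f : free_scale 0 f = 0.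
Proof. by apply/fsfunP => x; rewrite free_scaleE free_zeroE mul0r. Qed.

Fact free_scale1 : left_id 1 free_scale.
Proof. by move=> f; apply/fsfunP => x; rewrite free_scaleE mul1r. Qed.

Fact free_scaleDr : right_distributive free_scale +%R.
Proof.
move=> a f g; apply/fsfunP => x.
by rewrite !(free_scaleE, free_addE) mulrDr.
Qed.

Fact free_scaleDl f : {morph free_scale^~ f : a b / a + b}.
Proof.
move=> a b; apply/fsfunP => x.
by rewrite !(free_scaleE, free_addE) mulrDl.
Qed.

HB.instance Definition _ := GRing.Nmodule_isLSemiModule.Build R free_semimod
  free_scaleA free_scale0 free_scale1 free_scaleDr free_scaleDl.

End FreeSemimodule.

Definition projective (R : pzSemiRingType) (M : lSemiModType R) :=
  exists (X : choiceType) (i : {linear M -> free_semimod R X})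
    (p : {linear free_semimod R X -> M}), cancel i p.

Definition has_projective_minimal_left_ideal (R : pzSemiRingType) :=
  exists (I : set R) (hI : left_ideal I),
    minimal_left_ideal I /\ projective (left_ideal_elt hI).

(* Right ideals and right semimodules over R are left ideals and left
   semimodules over the converse semiring R^c. *)
Definition has_projective_minimal_right_ideal (R : pzSemiRingType) :=
  has_projective_minimal_left_ideal R^c.

(* GRing.field_axiom says that every nonzero element is a unit; it does not
   include commutativity, and 1 != 0 is part of unitRingType. *)
Definition division_ring (F : unitRingType) := GRing.field_axiom F.

Section Homomorphisms.
Variables R S : pzSemiRingType.

Definition isomorphic := exists f : {rmorphism R -> S}, bijective f.

Definition semiisomorphism (f : {rmorphism R -> S}) :=
  range f = setT /\ f @^-1` [set 0] = [set 0].

(* The image of an ideal under a surjective homomorphism is an ideal, so it is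
   proper as soon as it is not the whole of S. *)
Definition strong_semiisomorphism (f : {rmorphism R -> S}) :=
  semiisomorphism f /\
  forall I : set R, ideal I -> I <> setT -> f @` I <> setT.

Definition strongly_semiisomorphic :=
  exists f : {rmorphism R -> S}, strong_semiisomorphism f.

End Homomorphisms.

Section LatticeEndomorphisms.
Variables (d : Order.disp_t) (M : bLatticeType d).

Record lattice_end := LatticeEnd {
  lattice_end_fun :> M -> M;
  lattice_end0 : lattice_end_fun \bot%O = \bot%O;
  lattice_endU : {morph lattice_end_fun : x y / (x `|` y)%O}
}.

HB.instance Definition _ := gen_eqMixin lattice_end.
HB.instance Definition _ := gen_choiceMixin lattice_end.

Implicit Types f g h : lattice_end.

Fact lattice_endP f g : f =1 g -> f = g.
Proof.
case: f g => [f f0 fU] [g g0 gU] /= /funext fg; case: g / fg g0 gU => g0 gU.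
by congr LatticeEnd; apply: Prop_irrelevance.
Qed.

Definition end_zero : lattice_end.
Proof.
by exists (fun=> \bot%O) => // x y; rewrite joinxx.
Defined.

Definition end_add f g : lattice_end.
Proof.
exists (fun x => (f x `|` g x)%O); first by rewrite !lattice_end0 joinxx.
by move=> x y; rewrite !lattice_endU joinACA.
Defined.

Definition end_one : lattice_end.
Proof. by exists id. Defined.

Definition end_mul f g : lattice_end.
Proof.
exists (f \o g) => [|x y] /=; first by rewrite !lattice_end0.
by rewrite !lattice_endU.
Defined.

Fact end_addA : associative end_add.
Proof. by move=> f g h; apply: lattice_endP => x /=; rewrite joinA. Qed.

Fact end_addC : commutative end_add.
Proof. by move=> f g; apply: lattice_endP => x /=; rewrite joinC. Qed.

Fact end_add0 : left_id end_zero end_add.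
Proof. by move=> f; apply: lattice_endP => x /=; rewrite join0x. Qed.

Fact end_mulA : associative end_mul.
Proof. by move=> f g h; apply: lattice_endP. Qed.

Fact end_mul1 : left_id end_one end_mul.
Proof. by move=> f; apply: lattice_endP. Qed.

Fact end_mulr1 : right_id end_one end_mul.
Proof. by move=> f; apply: lattice_endP. Qed.

Fact end_mulDl : left_distributive end_mul end_add.
Proof. by move=> f g h; apply: lattice_endP. Qed.

Fact end_mulDr : right_distributive end_mul end_add.
Proof. by move=> f g h; apply: lattice_endP => x /=; rewrite lattice_endU. Qed.

Fact end_mul0 : left_zero end_zero end_mul.
Proof. by move=> f; apply: lattice_endP. Qed.

Fact end_mulr0 : right_zero end_zero end_mul.
Proof. by move=> f; apply: lattice_endP => x /=; rewrite lattice_end0. Qed.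

HB.instance Definition _ := GRing.isPzSemiRing.Build lattice_end
  end_addA end_addC end_add0 end_mulA end_mul1 end_mulr1
  end_mulDl end_mulDr end_mul0 end_mulr0.

End LatticeEndomorphisms.

(* Main.v *)
(* A projective minimal left ideal I = R x is isomorphic to R e for an
   idempotent e, and minimality makes e R e a division semiring; this condition
   on e is left-right symmetric.  If R is ideal-simple then R e R = R, so
   1 = \sum_(i < n) a_i b_i with a_i in R e and b_i in e R.  If 1 has an additive
   inverse, a system of minimal length satisfies b_i a_j = delta_ij e, and
   r |-> (b_i r a_j) is an isomorphism onto the matrices over e R e.  Otherwise
   sums and products of nonzero elements of e R e are nonzero, so that the
   supports {(i, j) | b_i r a_j != 0} compose as relations; r |-> support of r is
   then a homomorphism onto the endomorphisms of the lattice of subsets of 'I_n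
   fixed by the idempotent relation attached to r = 1. *)
Require Import Defs.
From HB Require Import structures.
From mathcomp Require Import all_boot all_order all_algebra.
From mathcomp Require Import finmap boolp classical_sets.

Set Implicit Arguments.
Unset Strict Implicit.
Unset Printing Implicit Defensive.

Local Open Scope ring_scope.

Import Order.TTheory GRing.Theory.

(** * Ideals, and transfer of ideal-simplicity along homomorphisms *)

Lemma image_ideal (R S : pzSemiRingType) (f : {rmorphism R -> S}) (I : set R) :
  range f = setT -> ideal I -> ideal (f @` I)%classic.
Proof.
move=> fT [[I0 ID IMl] IMr].
have pre y : exists x, f x = y.
  by have [x _ <-] : range f y; [rewrite fT|exists x].
split; first split.
- by exists 0; rewrite ?rmorph0.
- move=> _ _ [x Ix <-] [y Iy <-].
  by exists (x + y); rewrite ?rmorphD //; apply: ID.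
- move=> r _ [x Ix <-]; have [s <-] := pre r.
  by exists (s * x); rewrite ?rmorphM //; apply: IMl.
- move=> r _ [x Ix <-]; have [s <-] := pre r.
  by exists (x * s); rewrite ?rmorphM //; apply: IMr.
Qed.

Lemma ideal_sum (R : pzSemiRingType) (I : set R) (J : Type) (r : seq J)
    (P : pred J) (F : J -> R) :
  ideal I -> (forall j, P j -> I (F j)) -> I (\sum_(j <- r | P j) F j).
Proof.
by move=> [[I0 ID _] _] IF; apply: (big_ind I).
Qed.

(** Working criterion: an ideal is everything as soon as it contains 1. *)
Lemma ideal_simpleP (R : pzSemiRingType) :
  (forall (I : set R) x, ideal I -> I x -> x <> 0 -> I 1) <-> ideal_simple R.
Proof.
split=> [H I hI|H I x hI Ix x0]; last first.
  by case: (H _ hI) => IE; [rewrite IE /= in Ix|rewrite IE].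
have [[I0 _ IMl] _] := hI.
have [[x [Ix x0]]|nx] := pselect (exists x, I x /\ x <> 0).
  right; apply/seteqP; split=> // y _; rewrite -[y]mulr1.
  exact: IMl (H _ _ hI Ix x0).
left; apply/seteqP; split=> [x Ix /=|_ -> //].
by apply: contrapT => x0; apply: nx; exists x.
Qed.

(** The zero kernel makes the image of a nonzero ideal nonzero, hence all of [S]; strongness then
    forces the ideal to be all of [R]. *)
Lemma ideal_simple_strong (R S : pzSemiRingType) (f : {rmorphism R -> S}) :
  strong_semiisomorphism f -> ideal_simple S -> ideal_simple R.
Proof.
move=> [[fT f0] fP] /ideal_simpleP sS; apply/ideal_simpleP => I x hI Ix x0.
suff -> : I = setT by [].
apply: contrapT => /(fP _ hI); apply.
have hfI := image_ideal fT hI.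
have fx0 : f x <> 0.
  by move=> fx; apply: x0; have: (f @^-1` [set 0])%classic x by []; rewrite f0.
have fI1 := sS _ (f x) hfI (ex_intro2 _ _ _ Ix erefl) fx0.
apply/seteqP; split=> // y _; rewrite -[y]mulr1.
by case: hfI => [[_ _ IMl] _]; apply: IMl.
Qed.

(** Lets the matrix case share the transfer lemma with the lattice case. *)
Lemma iso_strong_semiisomorphism (R S : pzSemiRingType)
    (f : {rmorphism R -> S}) :
  bijective f -> strong_semiisomorphism f.
Proof.
move=> [g fK gK]; split; first split.
- by apply/seteqP; split=> // y _; exists (g y).
- apply/seteqP; split=> x /=; last by move=> ->; rewrite rmorph0.
  by move=> fx; rewrite -(fK x) fx -(rmorph0 f) fK.
- move=> I hI IT fI; apply: IT; apply/seteqP; split=> // x _.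
  have: (f @` I)%classic (f x) by rewrite fI.
  by move=> [y Iy /(can_inj fK) <-].
Qed.

(** * Ideal-simplicity of matrix rings over division rings *)

Lemma matrix_ideal_simple (F : unitRingType) n :
  division_ring F -> ideal_simple 'M[F]_n.
Proof.
move=> hF; apply/ideal_simpleP => I A hI IA A0.
have [i [j Aij]] : exists i j, A i j != 0.
  apply: contrapT => H; apply: A0; apply/matrixP => i j; rewrite mxE.
  by apply/eqP/negPn/negP => Aij; apply: H; exists i, j.
have unitA := hF _ Aij.
pose E k l (a : F) : 'M[F]_n := a *: delta_mx k l.
(* The [k]-th summand is the diagonal matrix unit at [k]: the outer factors move the entry [A i j]
   to position [(k, k)] and rescale it to 1. *)
have -> : 1 = \sum_k E k i (A i j)^-1 * A * E j k 1 :> 'M[F]_n.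
  apply/matrixP => k l; rewrite summxE /E.
  rewrite (bigD1 k) //= big1 ?addr0 => [|m mk].
    rewrite -!mulmxE scale1r !mxE (bigD1 j) //= big1 => [|p pj]; last first.
      by rewrite [delta_mx _ _ _ _]mxE (negPf pj) mulr0.
    rewrite addr0 !mxE (bigD1 i) //= big1 => [|p pi]; last first.
      by rewrite !mxE (negPf pi) andbF mulr0 mul0r.
    rewrite addr0 !mxE !eqxx mulr1 mulVr // mul1r eq_sym.
    by case: eqP.
  rewrite -!mulmxE scale1r !mxE big1 // => p _.
  rewrite !mxE big1 ?mul0r // => q _.
  by rewrite !mxE eq_sym (negPf mk) mulr0 mul0r.
apply: ideal_sum => // k _.
by case: hI => [[_ _ IMl] IMr]; apply/IMr/IMl.
Qed.

(** * Ideal-simplicity of endomorphism semirings of finite distributive lattices *)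

Section LatticeEndSimple.
Variables (d : Order.disp_t) (M : finTBDistrLatticeType d).

Definition join_prime (j : M) :=
  (j != \bot%O) &&
  [forall x, forall y, (j <= x `|` y)%O ==> (j <= x)%O || (j <= y)%O].

Lemma join_primeP j : reflect
  (j <> \bot%O /\ forall x y, (j <= x `|` y)%O = (j <= x)%O || (j <= y)%O)
  (join_prime j).
Proof.
apply: (iffP andP) => [[/eqP j0 /forallP H]|[j0 H]]; split=> //.
- move=> x y; apply/idP/idP.
    by have /forallP/(_ y)/implyP := H x.
  by case/orP => h; apply: le_trans h _; rewrite ?leUl ?leUr.
- exact/eqP.
- by apply/forallP => x; apply/forallP => y; rewrite H; apply/implyP.
Qed.

(* By well-founded induction: an element that is not join-prime is, by
   distributivity, a join of two strictly smaller ones. *)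
Lemma join_primes_le (x y : M) :
  (forall j, join_prime j -> (j <= x)%O -> (j <= y)%O) -> (x <= y)%O.
Proof.
have [n] := ubnP #|[set z : M | (z < x)%O]|; elim: n x => // n IHn x xn H.
have smaller u : (u < x)%O -> (u <= y)%O.
  move=> ux; apply: IHn => [|j jp ju]; last exact/H/(le_trans ju)/ltW.
  rewrite -ltnS; apply: leq_trans xn; rewrite ltnS.
  apply: proper_card; apply/properP; split.
    by apply/fintype.subsetP => z; rewrite !inE => /lt_trans; apply.
  by exists u; rewrite inE ?ltxx.
have [->|/eqP x0] := eqVneq x \bot%O; first exact: le0x.
have [/H|/join_primeP nj] := boolP (join_prime x); first exact.
have [u [v [xuv xu xv]]] :
    exists u v, [/\ (x <= u `|` v)%O, ~~ (x <= u)%O & ~~ (x <= v)%O].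
  apply: contrapT => nuv; apply: nj; split=> // u v.
  apply/idP/idP => [xuv|/orP[] h]; last 2 first.
  - by apply: le_trans h _; rewrite leUl.
  - by apply: le_trans h _; rewrite leUr.
  apply/negPn/negP; rewrite negb_or => /andP[xu xv].
  by apply: nuv; exists u, v.
have -> : x = ((x `&` u) `|` (x `&` v))%O by rewrite -meetUr meet_l.
by rewrite leUx !smaller // lt_neqAle leIl andbT -leEmeet.
Qed.

(** An elementary endomorphism: join-primality of [j] is what makes it preserve joins. *)
Definition prime_end_fun j b (x : M) := if (j <= x)%O then b : M else \bot%O.

Lemma prime_end_fun0 j b : join_prime j -> prime_end_fun j b \bot%O = \bot%O.
Proof.
by case/join_primeP => j0 _; rewrite /prime_end_fun lex0; case: eqP.
Qed.

Lemma prime_end_funU j b :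
  join_prime j -> {morph prime_end_fun j b : x y / (x `|` y)%O}.
Proof.
case/join_primeP => _ jU x y; rewrite /prime_end_fun jU.
by case: ifP; case: (j <= x)%O; case: (j <= y)%O => //= _;
  rewrite ?joinx0 ?join0x ?joinxx.
Qed.

Definition prime_end j b (jp : join_prime j) : lattice_end M :=
  LatticeEnd (prime_end_fun0 b jp) (@prime_end_funU j b jp).

(** Composing with this map on the left keeps only the information whether a value is nonzero. *)
Definition support_end_fun b (x : M) := if x == \bot%O then \bot%O else b : M.

Lemma support_end_funU b :
  {morph support_end_fun b : x y / (x `|` y)%O}.
Proof.
move=> x y; rewrite /support_end_fun join_eq0.
by case: (x == _); case: (y == _); rewrite ?joinx0 ?join0x ?joinxx.
Qed.

Lemma support_end_fun0 b : support_end_fun b \bot%O = \bot%O.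
Proof. by rewrite /support_end_fun eqxx. Qed.

Definition support_end b : lattice_end M :=
  LatticeEnd (support_end_fun0 b) (@support_end_funU b).

Lemma lattice_end_sumE (J : Type) (r : seq J) (F : J -> lattice_end M) x :
  (\sum_(j <- r) F j) x = (\join_(j <- r) F j x)%O.
Proof. by elim/big_rec2: _ => // j y f _ <-. Qed.

(** A nonzero [h] can be sandwiched into the map sending [x] to [j] if [j <= x] and to bottom
    otherwise; these maps join to the identity, as the join-primes below [x] determine [x]. *)
Lemma lattice_end_simple : ideal_simple (lattice_end M).
Proof.
apply/ideal_simpleP => I h hI Ih h0.
have [a ha] : exists a, h a <> \bot%O.
  apply: contrapT => H; apply: h0; apply: lattice_endP => x /=.
  by apply: contrapT => hx; apply: H; exists x.
(* [prime_end] feeds [a] to [h] exactly when [j <= x], and [support_end] turns the nonzero value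
   [h a] into [j]. *)
pose F (j : {j | join_prime j}) : lattice_end M :=
  support_end (val j) * h * prime_end a (valP j).
have FE j x : F j x = if (val j <= x)%O then val j else \bot%O.
  rewrite /= /prime_end_fun; case: ifP => _.
    by rewrite /support_end_fun; case: eqP.
  by rewrite lattice_end0 support_end_fun0.
have -> : 1 = \sum_j F j.
  apply: lattice_endP => x; rewrite lattice_end_sumE; apply: le_anti.
  apply/andP; split; last first.
    by apply/joinsP => j _; rewrite FE; case: ifP.
  apply: join_primes_le => j jp jx.
  have := @joins_sup _ _ _ (Sub j jp : {j | join_prime j}) predT (fun j => F j x) isT.
  by rewrite FE jx.
apply: ideal_sum => // j _.
by case: hI => [[_ _ IMl] IMr]; apply/IMr/IMl.
Qed.

End LatticeEndSimple.

(** * Idempotents whose corner is a division semiring *)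

Record division_corner (R : pzSemiRingType) (e : R) : Prop := DivisionCorner {
  corner_idem : e * e = e;
  corner_neq0 : e <> 0;
  corner_inv : forall x, e * x * e = x -> x <> 0 ->
    exists y, [/\ e * y * e = y, y * x = e & x * y = e]
}.

(** As for groups: a left inverse [y] of [x] has a left inverse [w] of its own, and
    [w = w * y * x = x]. *)
Lemma division_corner_left_inv (R : pzSemiRingType) (e : R) :
  e * e = e -> e <> 0 ->
  (forall x, e * x * e = x -> x <> 0 -> exists y, y * x = e) ->
  division_corner e.
Proof.
move=> ee e0 inv.
have inv' x : e * x * e = x -> x <> 0 -> exists y, e * y * e = y /\ y * x = e.
  move=> ex x0; have [y yx] := inv x ex x0; exists (e * y * e); split.
    by rewrite !mulrA ee -!mulrA ee.
  have ex' : e * x = x by rewrite -ex !mulrA ee.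
  by rewrite -!mulrA ex' yx ee.
split=> // x ex x0; have [y [ey yx]] := inv' x ex x0.
exists y; split=> //.
have [w [ew wy]] : exists w, e * w * e = w /\ w * y = e.
  by apply: inv' => // y0; apply: e0; rewrite -yx y0 mul0r.
suff -> : x = w by [].
have <- : e * x = x by rewrite -ex !mulrA ee.
by rewrite -wy -mulrA yx -ew -!mulrA ee.
Qed.

Lemma division_corner_conv (R : pzSemiRingType) (e : R) :
  division_corner (e : R^c) -> division_corner e.
Proof.
move=> [ee e0 inv]; split=> // x ex x0.
have [||y [ey yx xy]] := inv x => //.
  exact: etrans (mulrA (e : R) x e) ex.
by exists y; split=> //; rewrite -mulrA.
Qed.

(** Expansion in the basis of indicator functions, used to compute a linear map from its values on
    the basis. *)
Lemma free_semimod_sum (R : pzSemiRingType) (X : choiceType)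
    (f : free_semimod R X) :
  f = \sum_(k <- finsupp f)
        f k *: ([fsfun x in [fset k]%fset => 1 : R] : free_semimod R X).
Proof.
have sumE (s : seq X) (F : X -> free_semimod R X) x :
    (\sum_(k <- s) F k) x = \sum_(k <- s) F k x.
  elim/big_rec2: _ => [|k u v _ <-]; first exact: free_zeroE.
  exact: free_addE.
apply/fsfunP => x; rewrite sumE.
under eq_bigr => k _ do rewrite free_scaleE fsfun_fun in_fset1.
have [fx|fx] := boolP (x \in finsupp f).
  rewrite (big_fsetD1 x) //= eqxx mulr1 big_seq big1 ?addr0 // => k.
  by rewrite in_fsetD1 eq_sym => /andP[/negPf -> _]; rewrite mulr0.
rewrite (fsfun_dflt fx) big_seq big1 // => k fk.
by case: eqP fx => [->|_ _]; rewrite ?fk ?mulr0.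
Qed.

(* If x0 generates the minimal left ideal I, the surjection r |-> r x0 of R
   onto I splits; e is the image of x0 under the splitting, so that r |-> r e
   factors through r |-> r x0. *)
Lemma projective_minimal_division_corner (R : pzSemiRingType) :
  has_projective_minimal_left_ideal R -> exists e : R, division_corner e.
Proof.
move=> [I [hI [[_ I0 Imin] [X [i [p ip]]]]]].
have [x0 [Ix0 x0n0]] : exists x0, I x0 /\ x0 <> 0.
  apply: contrapT => H; apply: I0; apply/seteqP; split=> [x Ix /=|_ ->].
    by apply: contrapT => x0; apply: H; exists x.
  by have [] := hI.
(* By minimality, since [R x] is a nonzero left ideal inside [I]. *)
have gen x : I x -> x <> 0 -> forall y, I y -> exists r, y = r * x.
  move=> Ix xn0 y Iy.
  suff: [set r * x | r in [set: R]]%classic y by move=> [r _ <-]; exists r.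
  have [_ _ IM] := hI.
  rewrite (Imin [set r * x | r in [set: R]]%classic) //.
  - split; first by exists 0; rewrite ?mul0r.
    + by move=> _ _ [r _ <-] [s _ <-]; exists (r + s); rewrite ?mulrDl.
    + by move=> s _ [r _ <-]; exists (s * r); rewrite ?mulrA.
  - move=> x0E; apply: xn0.
    suff: [set r * x | r in [set: R]]%classic x by rewrite x0E.
    by exists 1; rewrite ?mul1r.
  - by move=> _ [r _ <-]; apply: IM.
pose xt : left_ideal_elt hI := Sub x0 (mem_set Ix0).
pose delta k : free_semimod R X := [fsfun x in [fset k]%fset => 1 : R].
have /choice[r rE] k : exists r : R, val (p (delta k)) = r * x0.
  by apply: gen => //; apply/set_mem/(valP (p (delta k))).
pose f := i xt.
(* As [p (delta k)] is [r k * x0], expanding [p f = x0] along the basis gives [e * x0 = x0]. *)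
pose e := \sum_(k <- finsupp f) f k * r k.
have ex0 : e * x0 = x0.
  have : val (p f) = x0 by rewrite ip.
  rewrite {1}(free_semimod_sum f) linear_sum raddf_sum => {2}<-.
  rewrite mulr_suml; apply: eq_bigr => k _.
  by rewrite linearZ /= -mulrA -rE.
(* Linearity of [i] gives [s *: f = t *: f], so [s] and [t] agree on every coefficient [f k]
   occurring in [e]. *)
have factor s t : s * x0 = t * x0 -> s * e = t * e.
  move=> stx; have stf : s *: f = t *: f.
    rewrite -!linearZ; congr (i _); apply: val_inj; exact: stx.
  rewrite !mulr_sumr; apply: eq_bigr => k _; rewrite !mulrA.
  by congr (_ * _); move/fsfunP/(_ k): stf; rewrite !free_scaleE.
have ee : e * e = e by rewrite (factor e 1) ?mul1r.
exists e; apply: division_corner_left_inv => //.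
  by move=> e0; apply: x0n0; rewrite -ex0 e0 mul0r.
move=> x exe xn0; have xe : x * e = x by rewrite -exe -mulrA ee.
(* If [x * x0] were 0, [factor] would give [x * e = 0]. The resulting [t] is a left inverse of [x],
   by [factor] again. *)
have [t tE] : exists t, x0 = t * (x * x0).
  apply: gen => //; first by have [_ _] := hI; apply.
  move=> xx0; apply: xn0; rewrite -xe (factor x 0) ?mul0r //.
exists t; rewrite -{1}xe mulrA (factor (t * x) 1) ?mul1r //.
by rewrite -mulrA -tE.
Qed.

Definition full_system (R : pzSemiRingType) (e : R) n (a b : 'I_n -> R) :=
  [/\ forall i, a i * e = a i, forall i, e * b i = b i &
      1 = \sum_i a i * b i].

(** [J] is the ideal generated by [e], so it contains 1; inserting [e = e * e] in each term puts the
    factors in [R e] and [e R]. *)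
Lemma ideal_simple_full (R : pzSemiRingType) (e : R) :
  e * e = e -> e <> 0 -> ideal_simple R ->
  exists n (a b : 'I_n -> R), full_system e a b.
Proof.
move=> ee e0 sR.
pose J := [set x | exists s : seq (R * R),
  x = \sum_(q <- s) q.1 * e * q.2]%classic.
have hJ : ideal J.
  split; first split.
  - by exists [::]; rewrite big_nil.
  - by move=> _ _ [s ->] [t ->]; exists (s ++ t); rewrite big_cat.
  - move=> r _ [s ->]; exists [seq (r * q.1, q.2) | q <- s].
    by rewrite big_map mulr_sumr; apply: eq_bigr => q _; rewrite !mulrA.
  - move=> r _ [s ->]; exists [seq (q.1, q.2 * r) | q <- s].
    by rewrite big_map mulr_suml; apply: eq_bigr => q _; rewrite !mulrA.
have [s s1] : J 1.
  apply: (proj2 (ideal_simpleP R) sR J e hJ _ e0).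
  by exists [:: (1, 1)]; rewrite big_seq1 mul1r mulr1.
exists (size s), (fun k => (nth 0 s k).1 * e), (fun k => e * (nth 0 s k).2).
split=> [k|k|]; rewrite -?mulrA ?ee // ?mulrA ?ee //.
rewrite {1}s1 (big_nth 0) big_mkord; apply: eq_bigr => k _.
by rewrite -!mulrA (mulrA e e) ee.
Qed.

(** Bundles a map whose morphism laws are only established in the course of a proof. *)
Lemma rmorphism_of (R S : pzSemiRingType) (g : R -> S) :
  g 0 = 0 -> {morph g : x y / x + y} -> g 1 = 1 -> {morph g : x y / x * y} ->
  exists f : {rmorphism R -> S}, f =1 g.
Proof.
move=> g0 gD g1 gM.
pose gA := GRing.isNmodMorphism.Build R S g (conj g0 gD).
pose gMon := GRing.isMonoidMorphism.Build R S g (conj g1 gM).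
pose f : {rmorphism R -> S} := HB.pack g gA gMon.
by exists f.
Qed.

(** * Arithmetic when 1 has an additive inverse [w] *)

Section NegOne.
Variables (R : pzSemiRingType) (w : R) (w1 : 1 + w = 0).

Lemma addr_mul_neg x : x + w * x = 0.
Proof. by rewrite -{1}[x]mul1r -mulrDl w1 mul0r. Qed.

Lemma neg_eq x y : x + y = 0 -> y = w * x.
Proof.
by move=> xy; rewrite -[y]add0r -(addr_mul_neg x) addrAC xy add0r.
Qed.

(** Both sides are additive inverses of [x], and these are unique. *)
Lemma mul_negC x : x * w = w * x.
Proof. by apply: neg_eq; rewrite -{1}[x]mulr1 -mulrDr w1 mulr0. Qed.

End NegOne.

(** * The corner as a division ring *)

Section CornerRing.
Variables (R : pzSemiRingType) (e w : R).
Hypotheses (hD : division_corner e) (w1 : 1 + w = 0).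

(* The proof arguments make the division ring structure inferable from the
   type. *)
Definition corner_ring of division_corner e & 1 + w = 0 : Type :=
  {x : R | e * x * e == x}.

Local Notation F := (corner_ring hD w1).

HB.instance Definition _ := SubChoice.on F.

Definition Corner x (xP : e * x * e == x) : F := exist _ x xP.

Implicit Types x y : F.

Let ee : e * e = e := corner_idem hD.

Fact corner_val x : e * val x * e = val x.
Proof. exact/eqP/(valP x). Qed.

Fact corner_zero_subproof : e * 0 * e == 0 :> R.
Proof. by rewrite mulr0 mul0r. Qed.
Fact corner_one_subproof : e * e * e == e.
Proof. by rewrite !ee. Qed.
Fact corner_add_subproof x y : e * (val x + val y) * e == val x + val y.
Proof. by rewrite mulrDr mulrDl !corner_val. Qed.
Fact corner_opp_subproof x : e * (w * val x) * e == w * val x.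
Proof. by rewrite mulrA (mul_negC w1) -!mulrA (mulrA e) corner_val. Qed.
Fact corner_mul_subproof x y : e * (val x * val y) * e == val x * val y.
Proof.
rewrite -(corner_val x) -(corner_val y) -!mulrA ee !mulrA ee.
by rewrite -!mulrA.
Qed.

Definition corner_zero : F := Corner corner_zero_subproof.
Definition corner_one : F := Corner corner_one_subproof.
Definition corner_add x y : F := Corner (corner_add_subproof x y).
Definition corner_opp x : F := Corner (corner_opp_subproof x).
Definition corner_mul x y : F := Corner (corner_mul_subproof x y).

Fact corner_mul1l x : e * val x = val x.
Proof. by rewrite -corner_val !mulrA ee. Qed.
Fact corner_mul1r x : val x * e = val x.
Proof. by rewrite -corner_val -!mulrA ee. Qed.

Fact corner_addA : associative corner_add.
Proof. by move=> x y t; apply: val_inj; rewrite /= addrA. Qed.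
Fact corner_addC : commutative corner_add.
Proof. by move=> x y; apply: val_inj; rewrite /= addrC. Qed.
Fact corner_add0 : left_id corner_zero corner_add.
Proof. by move=> x; apply: val_inj; rewrite /= add0r. Qed.
Fact corner_addN : left_inverse corner_zero corner_opp corner_add.
Proof. by move=> x; apply: val_inj; rewrite /= addrC addr_mul_neg. Qed.
Fact corner_mulA : associative corner_mul.
Proof. by move=> x y t; apply: val_inj; rewrite /= mulrA. Qed.
Fact corner_mul1 : left_id corner_one corner_mul.
Proof. by move=> x; apply: val_inj; rewrite /= corner_mul1l. Qed.
Fact corner_mulr1 : right_id corner_one corner_mul.
Proof. by move=> x; apply: val_inj; rewrite /= corner_mul1r. Qed.
Fact corner_mulDl : left_distributive corner_mul corner_add.
Proof. by move=> x y t; apply: val_inj; rewrite /= mulrDl. Qed.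
Fact corner_mulDr : right_distributive corner_mul corner_add.
Proof. by move=> x y t; apply: val_inj; rewrite /= mulrDr. Qed.
Fact corner_one_neq0 : corner_one != corner_zero.
Proof. by apply/eqP => /(congr1 val); apply: corner_neq0 hD. Qed.

HB.instance Definition _ := GRing.isNzRing.Build F
  corner_addA corner_addC corner_add0 corner_addN corner_mulA
  corner_mul1 corner_mulr1 corner_mulDl corner_mulDr corner_one_neq0.

Fact corner_inv_ex x : exists y : F, x != 0 -> y * x = 1 /\ x * y = 1.
Proof.
have [->|x0] := eqVneq x 0; first by exists 0.
have [|y [ey yx xy]] := corner_inv hD (corner_val x).
  by move=> vx; move/eqP: x0; apply; apply: val_inj.
exists (Corner (introT eqP ey)) => _.
by split; apply: val_inj.
Qed.

(** At zero the argument is returned, following the convention for inverses of non-units. *)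
Definition corner_inverse x : F :=
  if x == 0 then x else sval (cid (corner_inv_ex x)).

Fact corner_mulV : {in [pred x : F | x != 0], left_inverse 1 corner_inverse *%R}.
Proof.
move=> x; rewrite inE /corner_inverse => x0; rewrite ifN //.
by case: cid => y /= /(_ x0)[].
Qed.

Fact corner_mulrV :
  {in [pred x : F | x != 0], right_inverse 1 corner_inverse *%R}.
Proof.
move=> x; rewrite inE /corner_inverse => x0; rewrite ifN //.
by case: cid => y /= /(_ x0)[].
Qed.

Fact corner_unitP x y : y * x = 1 /\ x * y = 1 -> [pred x : F | x != 0] x.
Proof.
case=> yx _; apply/eqP => x0; move/eqP: yx.
by rewrite x0 mulr0 eq_sym oner_eq0.
Qed.

Fact corner_inv_out :
  {in [predC [pred x : F | x != 0]], corner_inverse =1 id}.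
Proof. by move=> x; rewrite !inE negbK /corner_inverse => x0; rewrite ifT. Qed.

HB.instance Definition _ := GRing.NzRing_hasMulInverse.Build F
  corner_mulV corner_mulrV corner_unitP corner_inv_out.

(** Holds by computation, the unit predicate having been chosen as [x != 0]. *)
Lemma corner_division_ring : division_ring F.
Proof. by []. Qed.

End CornerRing.

(** * Dual systems of minimal length and the matrix isomorphism *)

Section DualBases.
Variables (R : pzSemiRingType) (e w : R).
Hypotheses (hD : division_corner e) (w1 : 1 + w = 0).
Variables (n : nat) (a b : 'I_n -> R).
Hypothesis fab : full_system e a b.
Hypothesis minn : forall m (a' b' : 'I_m -> R), full_system e a' b' -> (n <= m)%N.

Let ee : e * e = e := corner_idem hD.

(* A nontrivial relation would express some a_k through the others, giving a
   shorter system. *)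
Lemma minimal_system_free (d : 'I_n -> R) :
  (forall i, e * d i * e = d i) -> \sum_i a i * d i = 0 -> forall i, d i = 0.
Proof.
have [aE bE ab1] := fab.
move=> dE ad0 k; apply: contrapT => /(corner_inv hD (dE k))[c [ec _ dc]].
case: n a b fab minn d dE ad0 k aE bE ab1 dc => [|m] A B fAB minm d dE ad0 k.
  by case: k.
move=> aE bE ab1 dc; suff: (m.+1 <= m)%N by rewrite ltnn.
pose s := \sum_(i < m) A (lift k i) * d (lift k i).
have sE : A k * d k = w * s.
  by apply: (neg_eq w1); rewrite addrC -ad0 (bigD1_ord k).
(* With [d k * c = e], the term [A k * B k] equals [A k * d k * c * B k = w * s * c * B k];
   spreading [s] over the other indices corrects each remaining [B i]. *)
apply: (minm m (fun i => A (lift k i))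
  (fun i => B (lift k i) + w * (d (lift k i) * c * B k))).
split=> // [i|].
  have de : e * d (lift k i) = d (lift k i) by rewrite -dE !mulrA ee.
  rewrite mulrDr bE (mulrA e) (mul_negC w1 e) -(mulrA w) !(mulrA e) de.
  by rewrite !mulrA.
under eq_bigr => i _ do rewrite mulrDr (mulrA (A _)) (mul_negC w1)
  -(mulrA w) -(mulrA (d _)) (mulrA (A _)).
rewrite big_split /= -mulr_sumr -mulr_suml -/s mulrA -sE.
by rewrite -(mulrA (A k)) (mulrA (d k)) dc bE addrC ab1 (bigD1_ord k).
Qed.

(** For fixed [j], the families [b i * a j] and [delta i] both give [a j] when combined with the
    [a i]; freeness applies to their difference. *)
Lemma minimal_system_dual i j : b i * a j = if i == j then e else 0.
Proof.
have [aE bE ab1] := fab.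
pose delta i := if i == j then e else 0.
have de k : e * delta k * e = delta k.
  by rewrite /delta; case: ifP => _; rewrite ?ee ?mulr0 ?mul0r.
suff d0 : b i * a j + w * delta i = 0.
  rewrite (neg_eq w1 (etrans (addrC _ _) d0)).
  exact/esym/(neg_eq w1 (etrans (addrC _ _) (addr_mul_neg w1 (delta i)))).
apply: (@minimal_system_free (fun i => b i * a j + w * delta i)) => [k|].
  rewrite mulrDr mulrDl !mulrA bE -(mulrA _ (a j)) aE (mul_negC w1 e).
  by rewrite -!mulrA (mulrA e) de.
under eq_bigr => k _ do rewrite mulrDr !mulrA (mul_negC w1) -(mulrA w).
rewrite big_split /= -mulr_suml -ab1 mul1r -mulr_sumr (bigD1 j) //= big1.
  by rewrite /delta eqxx aE addr0 addr_mul_neg.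
by move=> k /negPf kj; rewrite /delta kj mulr0.
Qed.

Local Notation F := (corner_ring hD w1).

(** Inserting [1 = \sum_k a k * b k] gives multiplicativity and recovers [r] from its coordinates;
    duality gives the image of 1 and surjectivity. *)
Lemma minimal_system_isomorphic : isomorphic R 'M[F]_n.
Proof.
have [aE bE ab1] := fab.
have cP i r j : e * (b i * r * a j) * e == b i * r * a j.
  by rewrite !mulrA bE -(mulrA _ (a j)) aE.
pose rho r : 'M[F]_n := \matrix_(i, j) Corner hD w1 (cP i r j).
have valS (G : 'I_n -> F) : val (\sum_k G k) = \sum_k val (G k).
  exact: (big_morph (val : F -> R)).
have [] := @rmorphism_of R 'M[F]_n rho.
- by apply/matrixP => i j; rewrite !mxE; apply: val_inj; rewrite /= mulr0 mul0r.
- move=> r s; apply/matrixP => i j; rewrite !mxE; apply: val_inj.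
  by rewrite /= mulrDr mulrDl.
- apply/matrixP => i j; rewrite !mxE; apply: val_inj.
  by rewrite /= mulr1 minimal_system_dual; case: eqP.
- move=> r s; apply/matrixP => i j; rewrite !mxE; apply: val_inj.
  rewrite valS /= -[r in LHS]mulr1 {1}ab1 mulr_sumr mulr_suml mulr_sumr mulr_suml.
  by apply: eq_bigr => k _; rewrite !mxE /= !mulrA.
move=> f fE; exists f.
exists (fun A : 'M[F]_n => \sum_i \sum_j a i * val (A i j) * b j) => [r|A].
  rewrite -[RHS]mul1r -[RHS]mulr1 {1 2}ab1 mulr_suml mulr_suml.
  apply: eq_bigr => i _; rewrite mulr_sumr; apply: eq_bigr => j _.
  by rewrite fE mxE /= !mulrA.
rewrite fE; apply/matrixP => k l; rewrite mxE; apply: val_inj => /=.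
rewrite mulr_sumr mulr_suml (bigD1 k) //= [X in _ + X]big1 => [|i ik].
  rewrite addr0 mulr_sumr mulr_suml (bigD1 l) //= big1 => [|j jl].
    rewrite addr0 !mulrA minimal_system_dual eqxx -mulrA minimal_system_dual.
    by rewrite eqxx corner_val.
  by rewrite -!mulrA minimal_system_dual (negPf jl) !mulr0.
rewrite mulr_sumr mulr_suml big1 // => j _.
by rewrite !mulrA minimal_system_dual eq_sym (negPf ik) !mul0r.
Qed.

End DualBases.

Lemma corner_matrix (R : pzSemiRingType) (e w : R) :
  division_corner e -> 1 + w = 0 -> ideal_simple R ->
  exists (F : unitRingType) (n : nat),
    [/\ division_ring F, (1 <= n)%N & isomorphic R 'M[F]_n].
Proof.
move=> hD w1 sR.
pose full n := exists a b : 'I_n -> R, full_system e a b.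
have exfull : exists n, `[< full n >].
  have [n [a [b fab]]] := ideal_simple_full (corner_idem hD) (corner_neq0 hD) sR.
  by exists n; apply/asboolP; exists a, b.
case: (ex_minnP exfull) => n /asboolP[a [b fab]] minn.
have minn' m (a' b' : 'I_m -> R) : full_system e a' b' -> (n <= m)%N.
  by move=> h; apply/minn/asboolP; exists a', b'.
exists (corner_ring hD w1), n; split.
- exact: corner_division_ring.
(* A system of length 0 would make 1 an empty sum, whence [e = 0]. *)
- case: n a b fab {minn minn'} => // a b [_ _]; rewrite big_ord0 => one0.
  by case: (corner_neq0 hD); rewrite -[e]mul1r one0 mul0r.
- exact: minimal_system_isomorphic fab minn'.
Qed.

(** * The distributive lattice of sets fixed by an idempotent relation *)

Section FixedSets.
Variables (T : finType).
Implicit Types (E : rel T) (A B : {set T}).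

(** [E i j] goes from [j] to [i], like a matrix acting on columns, so that composition follows the
    matrix product. *)
Definition rel_image E A := [set i | [exists j in A, E i j]].

Lemma rel_imageP E A i :
  reflect (exists2 j, j \in A & E i j) (i \in rel_image E A).
Proof. by rewrite inE; apply: (iffP exists_inP). Qed.

Lemma rel_imageU E A B :
  rel_image E (A :|: B) = rel_image E A :|: rel_image E B.
Proof.
apply/setP => i; rewrite finset.in_setU; apply/rel_imageP/orP.
  by case=> j /setUP[] jX Eij; [left|right]; apply/rel_imageP; exists j.
by case=> /rel_imageP[j jX Eij]; exists j; rewrite // finset.in_setU jX ?orbT.
Qed.

Lemma rel_image0 E : rel_image E finset.set0 = finset.set0.
Proof.
by apply/setP => i; rewrite [RHS]inE; apply/rel_imageP => -[j]; rewrite inE.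
Qed.

Lemma rel_imageS E A B : A \subset B -> rel_image E A \subset rel_image E B.
Proof.
move=> /fintype.subsetP AB; apply/fintype.subsetP => i /rel_imageP[j /AB jB Eij].
by apply/rel_imageP; exists j.
Qed.

Variables (E : rel T).
Hypothesis EE : idempotent_fun (rel_image E).

Definition fixed_set of idempotent_fun (rel_image E) : Type :=
  {A : {set T} | rel_image E A == A}.

Local Notation M := (fixed_set EE).

HB.instance Definition _ := SubFinite.on M.

Definition FixedSet A (AE : rel_image E A == A) : M := exist _ A AE.

Implicit Types X Y Z : M.

Lemma fixed_setE X : rel_image E (val X) = val X.
Proof. exact/eqP/(valP X). Qed.

Fact rel_image_fixed A : rel_image E (rel_image E A) == rel_image E A.
Proof. exact/eqP/EE. Qed.

Definition fixed_image A : M := FixedSet (rel_image_fixed A).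

Fact fixed_union_subproof X Y :
  rel_image E (val X :|: val Y) == val X :|: val Y.
Proof. by rewrite rel_imageU !fixed_setE. Qed.

Definition fixed_union X Y : M := FixedSet (fixed_union_subproof X Y).

(** The intersection need not be fixed; its image is the largest fixed set inside it. *)
Definition fixed_inter X Y : M := fixed_image (val X :&: val Y).

Definition fixed_le X Y := val X \subset val Y.

Fact fixed_le_refl : reflexive fixed_le.
Proof. by move=> X; apply: fintype.subxx. Qed.
Fact fixed_le_anti : antisymmetric fixed_le.
Proof. by move=> X Y; rewrite /fixed_le -finset.eqEsubset => /eqP/val_inj. Qed.
Fact fixed_le_trans : transitive fixed_le.
Proof. by move=> Y X Z; apply: fintype.subset_trans. Qed.

Definition fixed_display : Order.disp_t := Order.Disp tt tt.

HB.instance Definition _ := Order.Le_isPOrder.Build fixed_display M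
  fixed_le_refl fixed_le_anti fixed_le_trans.

Fact fixed_interP X Y Z : (X <= fixed_inter Y Z)%O = (X <= Y)%O && (X <= Z)%O.
Proof.
have inter_le (W : M) : val Y :&: val Z \subset val W -> (fixed_inter Y Z <= W)%O.
  by move=> /(rel_imageS E); rewrite fixed_setE.
apply/idP/andP => [XI|[XY XZ]].
  by split; apply: le_trans XI _; apply: inter_le;
    rewrite ?finset.subsetIl ?finset.subsetIr.
have : val X \subset val Y :&: val Z by rewrite finset.subsetI [_ \subset _]XY.
by move=> /(rel_imageS E); rewrite fixed_setE.
Qed.

Fact fixed_unionP X Y Z : (fixed_union X Y <= Z)%O = (X <= Z)%O && (Y <= Z)%O.
Proof. exact: finset.subUset. Qed.

HB.instance Definition _ :=
  Order.POrder_MeetJoin_isLattice.Build fixed_display M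
    fixed_interP fixed_unionP.

(** Joins are plain unions, and [rel_image] preserves unions. *)
Fact fixed_interUl : left_distributive fixed_inter fixed_union.
Proof.
by move=> X Y Z; apply: val_inj; rewrite /= finset.setIUl rel_imageU.
Qed.

HB.instance Definition _ :=
  Order.Lattice_Meet_isDistrLattice.Build fixed_display M fixed_interUl.

Definition fixed_bottom : M := fixed_image finset.set0.
Definition fixed_top : M := fixed_image finset.setT.

Fact fixed_le0 X : (fixed_bottom <= X)%O.
Proof. by rewrite /Order.le /= /fixed_le /= rel_image0 finset.sub0set. Qed.

Fact fixed_le1 X : (X <= fixed_top)%O.
Proof.
by have := rel_imageS E (finset.subsetT (val X)); rewrite fixed_setE.
Qed.

HB.instance Definition _ :=
  Order.hasBottom.Build fixed_display M fixed_le0.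
HB.instance Definition _ :=
  Order.hasTop.Build fixed_display M fixed_le1.

Definition fixed_lattice : finTBDistrLatticeType fixed_display := M.

End FixedSets.

Lemma lattice_end_mono (d : Order.disp_t) (M : bLatticeType d)
    (h : lattice_end M) : {homo h : x y / (x <= y)%O}.
Proof. by move=> x y; rewrite !leEjoin -lattice_endU => /eqP ->. Qed.

(** * The support homomorphism when 1 has no additive inverse *)

Section SupportMorphism.
Variables (R : pzSemiRingType) (e : R).
Hypothesis hD : division_corner e.
Variables (n : nat) (a b : 'I_n -> R).
Hypothesis fab : full_system e a b.
Hypothesis noneg : ~ exists w : R, 1 + w = 0.

Let ee : e * e = e := corner_idem hD.

(** If [x] had an inverse [c] in the corner, then [e + c * y = 0], and sandwiching [c * y] between
    the [a i] and [b i] would give an additive inverse of 1. *)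
Lemma corner_zerosumfree x y :
  e * x * e = x -> x + y = 0 -> x = 0.
Proof.
move=> ex xy; apply: contrapT => /(corner_inv hD ex)[c [_ cx _]].
have [aE bE ab1] := fab.
apply: noneg; exists (\sum_i a i * (c * y) * b i).
rewrite {1}ab1 -big_split /= big1 // => i _.
by rewrite -{1}(aE i) -mulrDl -mulrDr -cx -mulrDr xy mulr0 mulr0 mul0r.
Qed.

Lemma corner_mul_neq0 x y :
  e * x * e = x -> e * y * e = y ->
  (x * y != 0) = (x != 0) && (y != 0).
Proof.
move=> ex ey; have [->|/eqP x0] := eqVneq x 0; first by rewrite mul0r eqxx.
have [c [_ cx _]] := corner_inv hD ex x0.
congr (~~ _); apply/eqP/eqP => [xy|->]; last by rewrite mulr0.
have <- : e * y = y by rewrite -ey !mulrA ee.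
by rewrite -cx -mulrA xy mulr0.
Qed.

Lemma corner_sum_neq0 (J : finType) (F : J -> R) :
  (forall j, e * F j * e = F j) ->
  (\sum_j F j != 0) = [exists j, F j != 0].
Proof.
move=> FE; apply/idP/existsP => [|[j]].
  move=> F0; apply: contrapT => H; move/negP: F0; apply.
  by rewrite big1 // => j _; apply/eqP/negPn/negP => Fj; apply: H; exists j.
apply: contraNneq; rewrite (bigD1 j) //= => /(corner_zerosumfree (FE j)) ->.
by [].
Qed.

Definition coord_rel r : rel 'I_n := fun i j => b i * r * a j != 0.

Lemma coord_corner r i j : e * (b i * r * a j) * e = b i * r * a j.
Proof. by have [aE bE _] := fab; rewrite !mulrA bE -(mulrA _ (a j)) aE. Qed.

(** Coordinates multiply as matrices, and without cancellation or zero divisors an entry of the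
    product is nonzero exactly when one of its terms is. *)
Lemma coord_relM r s A :
  rel_image (coord_rel (r * s)) A =
  rel_image (coord_rel r) (rel_image (coord_rel s) A).
Proof.
have [aE bE ab1] := fab.
have coordM i k : coord_rel (r * s) i k =
    [exists j, coord_rel r i j && coord_rel s j k].
  rewrite /coord_rel.
  have -> : b i * (r * s) * a k = \sum_j (b i * r * a j) * (b j * s * a k).
    rewrite -[r in LHS]mulr1 {1}ab1 mulr_sumr mulr_suml mulr_sumr mulr_suml.
    by apply: eq_bigr => j _; rewrite !mulrA.
  rewrite corner_sum_neq0 => [|j].
    by apply: eq_existsb => j; rewrite corner_mul_neq0 ?coord_corner.
  by rewrite !mulrA bE -(mulrA _ (a k)) aE.
apply/setP => i; apply/rel_imageP/rel_imageP.
  case=> k kA; rewrite coordM => /existsP[j /andP[rij sjk]].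
  by exists j => //; apply/rel_imageP; exists k.
case=> j /rel_imageP[k kA sjk] rij; exists k => //.
by rewrite coordM; apply/existsP; exists j; rewrite rij.
Qed.

Lemma coord_relD r s i j :
  coord_rel (r + s) i j = coord_rel r i j || coord_rel s i j.
Proof.
rewrite /coord_rel mulrDr mulrDl.
apply/idP/orP => [|[]].
- by have [->|] := eqVneq (b i * r * a j) 0; [rewrite add0r; right|left].
- by apply: contraNN => /eqP/(corner_zerosumfree (coord_corner r i j)) ->.
- rewrite addrC.
  by apply: contraNN => /eqP/(corner_zerosumfree (coord_corner s i j)) ->.
Qed.

(** The system need not be dual here, so 1 may give a relation other than equality; hence the
    restriction to its fixed sets. *)
Lemma coord_rel_idem : idempotent_fun (rel_image (coord_rel 1)).
Proof. by move=> A; rewrite /= -coord_relM mulr1. Qed.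

Local Notation L := (fixed_lattice coord_rel_idem).
Local Notation set_of X := (val (X : fixed_set coord_rel_idem)).

Lemma set_of_bottom : set_of (\bot%O : L) = finset.set0.
Proof. exact: rel_image0. Qed.

Lemma set_ofU (X Y : L) : set_of (X `|` Y)%O = set_of X :|: set_of Y.
Proof. by []. Qed.

Fact support_map_subproof r (X : L) :
  rel_image (coord_rel 1) (rel_image (coord_rel r) (set_of X)) ==
  rel_image (coord_rel r) (set_of X).
Proof. by rewrite -coord_relM mul1r. Qed.

Definition support_map_fun r (X : L) : L :=
  FixedSet coord_rel_idem (support_map_subproof r X).

Fact support_map0 r : support_map_fun r \bot%O = \bot%O.
Proof. by apply: val_inj; rewrite /= !rel_image0. Qed.

Fact support_mapU r : {morph support_map_fun r : X Y / (X `|` Y)%O}.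
Proof. by move=> X Y; apply: val_inj; rewrite set_ofU /= rel_imageU. Qed.

Definition support_map r : lattice_end L :=
  LatticeEnd (support_map0 r) (@support_mapU r).

Lemma support_mapE r (X : L) :
  set_of (support_map r X) = rel_image (coord_rel r) (set_of X).
Proof. by []. Qed.

(** Singletons need not be fixed, and this set need not even contain [j]. *)
Definition principal j : L := fixed_image coord_rel_idem [set j]%SET.

(** The coordinates [b i * r * a j] determine [r], and a nonzero one is detected on
    [principal j]. *)
Lemma support_map_eq0 r : support_map r = 0 -> r = 0.
Proof.
have [aE bE ab1] := fab.
move=> r0; rewrite -[r]mul1r -[1 * r]mulr1 {1 2}ab1 mulr_suml mulr_suml.
rewrite big1 // => i _; rewrite mulr_sumr big1 // => j _.
suff br0 : b i * r * a j = 0.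
  by rewrite -!mulrA (mulrA (b i)) (mulrA _ (a j)) br0 mul0r mulr0.
apply/eqP/negPn/negP => rij.
have : i \in set_of (support_map r (principal j)).
  rewrite support_mapE -coord_relM mulr1; apply/rel_imageP.
  by exists j; rewrite ?finset.in_set1.
by rewrite r0 set_of_bottom finset.in_set0.
Qed.

Lemma mem_fixed_join (J : eqType) (s : seq J) (Y : J -> L) k :
  k \in set_of (\join_(j <- s) Y j)%O -> exists2 j, j \in s & k \in set_of (Y j).
Proof.
elim: s => [|j s IHs]; first by rewrite big_nil set_of_bottom finset.in_set0.
rewrite big_cons set_ofU => /finset.setUP[kj|/IHs[i si ki]].
  by exists j; rewrite ?mem_head.
by exists i; rewrite // in_cons si orbT.
Qed.

Lemma principal_le j (X : L) : j \in set_of X -> (principal j <= X)%O.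
Proof.
rewrite -finset.sub1set => /(rel_imageS (coord_rel 1)).
by rewrite (fixed_setE X).
Qed.

Lemma fixed_join_principal (X : L) : X = (\join_(j <- enum (set_of X)) principal j)%O.
Proof.
apply: le_anti; apply/andP; split.
  apply/fintype.subsetP => i; rewrite -[in i \in _](fixed_setE X).
  move=> /rel_imageP[j jX Eij].
  have jE : j \in enum (set_of X) by rewrite mem_enum.
  have /fintype.subsetP := joins_sup_seq principal jE (isT : predT j).
  by apply; apply/rel_imageP; exists j; rewrite ?finset.in_set1.
by apply/joinsP_seq => j; rewrite mem_enum => /principal_le.
Qed.

(** An endomorphism is determined by its values on the principal sets. The preimage has matrix [c],
    whose support records those values. *)
Lemma support_map_surj (h : lattice_end L) : exists r, support_map r = h.
Proof.
have [aE bE ab1] := fab.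
pose c (q : 'I_n * 'I_n) := if q.1 \in set_of (h (principal q.2)) then e else 0.
exists (\sum_q a q.1 * c q * b q.2).
have cE q : e * c q * e = c q.
  by rewrite /c; case: ifP => _; rewrite ?ee ?mulr0 ?mul0r.
(* The relation obtained is the support of [c] composed on both sides with the relation of 1, which
   is harmless on fixed sets. *)
have coordE k l : coord_rel (\sum_q a q.1 * c q * b q.2) k l =
    [exists q, [&& coord_rel 1 k q.1, c q != 0 & coord_rel 1 q.2 l]].
  rewrite /coord_rel mulr_sumr mulr_suml corner_sum_neq0 => [|q]; last first.
    exact: coord_corner.
  apply: eq_existsb => q.
  have -> : b k * (a q.1 * c q * b q.2) * a l =
      (b k * 1 * a q.1) * (c q * (b q.2 * 1 * a l)).
    by rewrite !mulr1 !mulrA.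
  rewrite corner_mul_neq0 ?coord_corner //.
    by rewrite (corner_mul_neq0 (cE q) (coord_corner 1 _ _)).
  by rewrite mulr1 -[c q]cE !mulrA ee -(mulrA _ (a l)) aE.
apply: lattice_endP => X; apply: val_inj; rewrite support_mapE.
apply/setP => k; apply/rel_imageP/idP => [[l lX]|].
  rewrite coordE => /existsP[q /and3P[kq cq ql]].
  have qh : q.1 \in set_of (h (principal q.2)).
    by move: cq; rewrite /c; case: ifP; rewrite ?eqxx.
  have qX : q.2 \in set_of X by rewrite -fixed_setE; apply/rel_imageP; exists l.
  have /(@lattice_end_mono _ _ h)/fintype.subsetP hX : (principal q.2 <= X)%O
    by apply: principal_le.
  by rewrite -fixed_setE; apply/rel_imageP; exists q.1; rewrite ?hX.
(* Since [h] preserves joins, [k] lies in some [h (principal j)] with [j] in [X]; fixedness of both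
   sets supplies the outer links [ki] and [jl]. *)
rewrite {1}(fixed_join_principal X).
rewrite (big_morph h (lattice_endU h) (lattice_end0 h)).
move=> /mem_fixed_join[j]; rewrite mem_enum => jX.
rewrite -fixed_setE => /rel_imageP[i ih ki].
move: jX; rewrite -{1}fixed_setE => /rel_imageP[l lX jl].
exists l => //; rewrite coordE; apply/existsP; exists (i, j).
rewrite ki jl andbT /= /c ih; exact/eqP/(corner_neq0 hD).
Qed.

Lemma support_strong_semiisomorphism :
  ideal_simple R -> strongly_semiisomorphic R (lattice_end L).
Proof.
move=> sR.
have [||||f fE] := @rmorphism_of R (lattice_end L) support_map.
- apply: lattice_endP => X; apply: val_inj; rewrite support_mapE set_of_bottom.
  apply/setP => i; rewrite finset.in_set0; apply/rel_imageP => -[j _].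
  by rewrite /coord_rel mulr0 mul0r eqxx.
- move=> r s; apply: lattice_endP => X; apply: val_inj; rewrite set_ofU.
  rewrite !support_mapE; apply/setP => i; rewrite finset.in_setU.
  apply/rel_imageP/orP.
    move=> [j jX]; rewrite coord_relD => /orP[] rij; [left|right];
    by apply/rel_imageP; exists j.
  by case=> /rel_imageP[j jX rij]; exists j; rewrite // coord_relD rij ?orbT.
- apply: lattice_endP => X; apply: val_inj.
  by rewrite support_mapE fixed_setE.
- move=> r s; apply: lattice_endP => X; apply: val_inj.
  by rewrite support_mapE coord_relM.
have f0 r : f r = 0 -> r = 0 by rewrite fE; apply: support_map_eq0.
exists f; split; first split.
- apply/seteqP; split=> // h _; have [r <-] := support_map_surj h.
  by exists r.
- by apply/seteqP; split=> r /=; [apply: f0|move=> ->; rewrite rmorph0].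
(* By ideal-simplicity a proper ideal is zero; were its image everything, 1 would be in the
   kernel. *)
- move=> I hI IT fI; have [I0|//] := sR I hI.
  have: (f @` I)%classic 1 by rewrite fI.
  rewrite I0 => -[_ -> f01]; have /f0 one0 : f 1 = 0 by rewrite rmorph1 -f01 rmorph0.
  by apply: (corner_neq0 hD); rewrite -[e]mul1r one0 mul0r.
Qed.

(** On a trivial lattice 1 would act as zero, contradicting injectivity at 0. *)
Lemma fixed_lattice_neq0 : exists X : L, X <> \bot%O.
Proof.
apply: contrapT => H; apply: (corner_neq0 hD).
suff one0 : 1 = 0 :> R by rewrite -[e]mul1r one0 mul0r.
apply: support_map_eq0; apply: lattice_endP => X.
by apply: contrapT => hX; apply: H; exists (support_map 1 X).
Qed.

End SupportMorphism.

(** * The characterisation of ideal-simplicity *)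

Theorem corollary5p13 (R : pzSemiRingType)
    (hR : has_projective_minimal_left_ideal R \/
          has_projective_minimal_right_ideal R) :
  ideal_simple R <->
    (exists (F : unitRingType) (n : nat),
       [/\ division_ring F, (1 <= n)%N & isomorphic R 'M[F]_n]) \/
    (exists (d : Order.disp_t) (M : finTBDistrLatticeType d),
       (exists x : M, x <> \bot%O) /\
       strongly_semiisomorphic R (lattice_end M)).
Proof.
have [e hD] : exists e : R, division_corner e.
  (* A minimal right ideal gives an idempotent of the converse semiring, and the corner condition is
     symmetric. *)
  case: hR => /projective_minimal_division_corner // -[e /division_corner_conv].
  by exists e.
split=> [sR|[[F [n [hF _ [f bf]]]]|[d [M [_ [f hf]]]]]].
- have [[w w1]|noneg] := pselect (exists w : R, 1 + w = 0).
    by left; apply: corner_matrix hD w1 sR.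
  right.
  have [n [a [b fab]]] := ideal_simple_full (corner_idem hD) (corner_neq0 hD) sR.
  exists fixed_display, (fixed_lattice (coord_rel_idem hD fab noneg)); split.
    exact: fixed_lattice_neq0.
  exact: support_strong_semiisomorphism.
- exact: ideal_simple_strong (iso_strong_semiisomorphism bf)
    (matrix_ideal_simple hF).
- exact: ideal_simple_strong hf (@lattice_end_simple _ _).
Qed.
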